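(* Let $n\ge1$ and let $\sigma\in\mathfrak S_n$ be an $n$-cycle. Then $\sigma\in\Sigma_{(n)}$ if and only if $\sigma$ is oscillating and has connected intervals.
   Context: $[a,b]=\{c\in\mathbb Z\mid a\le c\le b\}$ and $[a]=[1,a]$. $\mathfrak S_n$ is the symmetric group on $[n]$ (products are compositions of functions), with Coxeter generators $s_i=(i,i+1)$ and Coxeter length function $\ell$ (number of inversions). Relation $\approx$: write $w\overset{s_i}{\to}w'$ if $w'=s_iws_i$ and $\ell(w')\le\ell(w)$. Let $\to$ be the reflexive and transitive closure of the union of the relations $\overset{s_i}{\to}$, $1\le i\le n-1$. Write $w\approx w'$ if $w\to w'$ and $w'\to w$; this is an equivalence relation on $\mathfrak S_n$. Let $(x_1,\dots,x_n)$ be the list with $x_{2i-1}=i$ and $x_{2i}=n-i+1$. The element in stair form $\sigma_{(n)}$ is the $n$-cycle $(x_1,x_2,\dots,x_n)$, i.e. $(1,n,2,n-1,\dots)$, and $\Sigma_{(n)}$ is the $\approx$-equivalence class of $\sigma_{(n)}$ in $\mathfrak S_n$. An $n$-cycle $\sigma\in\mathfrak S_n$ is called oscillating if there is a positive integer $m\in\{\frac{n-1}2,\frac n2,\frac{n+1}2\}$ such that $\sigma([m])=[n-m+1,n]$. A subset $M\subseteq[n]$ is connected in $\sigma$ if there is $m\in M$ with $M=\{m,\sigma(m),\sigma^2(m),\dots,\sigma^{|M|-1}(m)\}$. An $n$-cycle $\sigma\in\mathfrak S_n$ has connected intervals if $[k,n-k+1]$ is connected in $\sigma$ for all integers $k$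 with $1\le k\le\frac n2$. *)

(* Defs.v *)
From mathcomp Require Import all_boot all_fingroup zify.

Set Implicit Arguments.
Unset Strict Implicit.
Unset Printing Implicit Defensive.

(* Convention: the ordinal i : 'I_n (0 <= i < n) stands for the integer i + 1
   of [n] = {1, ..., n}. *)

Definition intv (n a b : nat) : {set 'I_n} :=
  [set i : 'I_n | a <= i.+1 <= b].

(* Coxeter length, as the number of inversions *)
Definition coxlen (n : nat) (w : 'S_n) : nat :=
  #|[set p : 'I_n * 'I_n | (p.1 < p.2) && (w p.2 < w p.1)]|.

(* w' = s_i w s_i with l(w') <= l(w) for some Coxeter generator s_i = (i, i+1).
   MathComp multiplies permutations from left to right; this does not matter
   here since the product s_i w s_i is palindromic. *)
Definition cyc_step (n : nat) : rel 'S_n := fun w w' =>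
  [exists i : 'I_n, exists j : 'I_n,
    [&& j == i.+1 :> nat,
        w' == (tperm i j * w * tperm i j)%g
      & coxlen w' <= coxlen w]].

(* w -> w' : reflexive transitive closure of cyc_step *)
Definition cyc_to (n : nat) : rel 'S_n := connect (@cyc_step n).

Definition cyc_equiv (n : nat) : rel 'S_n := fun w w' =>
  cyc_to w w' && cyc_to w' w.

(* The cycle (c_1, ..., c_k): each c_i is sent to its successor in c, viewed
   cyclically, and the elements not in c are fixed. *)
Definition cycle_perm (n : nat) (c : seq 'I_n) (Uc : uniq c) : 'S_n :=
  perm (can_inj (prev_next Uc)).

(* x_(2i-1) = i and x_(2i) = n - i + 1; only used for 1 <= j <= n. *)
Definition stair_val (n j : nat) : nat :=
  if odd j then j.+1./2 else n - j./2 + 1.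

Lemma stair_val_lt (n : nat) (j : 'I_n) : (stair_val n j.+1).-1 < n.
Proof. by have := ltn_ord j; rewrite /stair_val; case: ifP; lia. Qed.

Definition stair_ord (n : nat) (j : 'I_n) : 'I_n := Ordinal (stair_val_lt j).

Definition stair_seq (n : nat) : seq 'I_n :=
  [seq stair_ord j | j <- enum 'I_n].

Lemma stair_seq_uniq (n : nat) : uniq (stair_seq n).
Proof.
rewrite map_inj_uniq ?enum_uniq // => i j /(congr1 val) /= eq_ij.
apply: val_inj => /=; move: eq_ij (ltn_ord i) (ltn_ord j).
by rewrite /stair_val; case: ifP; case: ifP; lia.
Qed.

(* The element in stair form: the n-cycle (1, n, 2, n - 1, ...) *)
Definition stair_perm (n : nat) : 'S_n := cycle_perm (stair_seq_uniq n).

Definition stair_class (n : nat) : {set 'S_n} :=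
  [set w | cyc_equiv (stair_perm n) w].

Definition is_ncycle (n : nat) (w : 'S_n) : Prop :=
  porbits w = [set [set: 'I_n]].

(* The three alternatives are m = (n-1)/2, m = n/2 and m = (n+1)/2. *)
Definition oscillating (n : nat) (w : 'S_n) : Prop :=
  exists m : nat,
    [/\ 0 < m,
        [|| m.*2.+1 == n, m.*2 == n | m.*2 == n.+1]
      & w @: intv n 1 m = intv n (n - m + 1) n].

Definition connected_in (n : nat) (w : 'S_n) (M : {set 'I_n}) : Prop :=
  exists2 m, m \in M & M = [set x in traject w m #|M|].

Definition connected_intervals (n : nat) (w : 'S_n) : Prop :=
  forall k : nat, 1 <= k -> k.*2 <= n -> connected_in w (intv n k (n - k + 1)).

(* Main.v *)
Require Import Defs.
From mathcomp Require Import all_boot all_fingroup zify.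

Set Implicit Arguments.
Unset Strict Implicit.
Unset Printing Implicit Defensive.

(* Write an n-cycle as a cyclic list. If it has connected intervals, the arcs
   [k, n-k+1] are nested, and each one arises from the previous one by putting
   the two values k and n-k+1 both on the left (L), both on the right (R), or
   one on each side (D). If it is also oscillating, low and high values
   alternate (except at the middle value for odd n), so that the order of the
   two new values is forced, and the cycle is encoded by a word in L, R, D.

   Conjugation by s_i exchanges i and i+1 in the list, and it preserves the
   length iff exactly one of the pairs (sigma(i), sigma(i+1)) and
   (sigma^-1(i), sigma^-1(i+1)) is increasing. If i and i+1 are added at
   consecutive steps, comparing neighbours shows that this happens exactly when
   the exchange rewrites two consecutive letters by LD <-> DL, RD <-> DR,
   LR <-> DD or RL <-> DD, up to the facts that the outermost letter may be
   changed freely and that an innermost R may be replaced by L when n is even.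
   For odd n there are also moves at the middle value.
   These moves keep us among the encoded cycles and connect any word to
   L...L, which encodes the element in stair form. *)

(** * Conjugation by a Coxeter generator and length *)

(** The pair [(a, b)] is an inversion of [w] exactly when [(w b, w a)] is one of its inverse. *)
Lemma coxlenV n (w : 'S_n) : coxlen w^-1%g = coxlen w.
Proof.
pose f (p : 'I_n * 'I_n) := (w p.2, w p.1).
have f_inj : injective f by move=> [a b] [c d] [/perm_inj -> /perm_inj ->].
rewrite /coxlen -[RHS](card_imset _ f_inj); apply: eq_card => -[a b].
apply/idP/imsetP => [|[[c d]]]; rewrite inE /=.
  move=> /andP[lt_ab lt_w]; exists (w^-1 b, w^-1 a)%g; last by rewrite /f /= !permKV.
  by rewrite inE /= !permKV lt_w.
by rewrite inE /= => /andP[lt_cd lt_w] [-> ->]; rewrite !permK lt_w.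
Qed.

Lemma ltn_tperm n (i j p q : 'I_n) : j = i.+1 :> nat ->
    ~~ ((p == i) && (q == j)) -> ~~ ((p == j) && (q == i)) ->
  (tperm i j p < tperm i j q) = (p < q).
Proof.
move=> ji; rewrite !permE /= -!val_eqE /= => h1 h2.
by do !case: ifP => /eqP; lia.
Qed.

(** Renaming both coordinates by [tperm i j] embeds the inversions of [w] into those of the product,
    and [(i, j)] is the only new one. *)
Lemma coxlen_tpermM n (i j : 'I_n) (w : 'S_n) :
  j = i.+1 :> nat -> w i < w j -> coxlen (tperm i j * w) = (coxlen w).+1.
Proof.
move=> ji lt_w; pose f (p : 'I_n * 'I_n) := (tperm i j p.1, tperm i j p.2).
have f_inj : injective f by move=> [a b] [c d] [/perm_inj -> /perm_inj ->].
set I := [set p : 'I_n * 'I_n | (p.1 < p.2) && (w p.2 < w p.1)].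
have notI : (i, j) \notin f @: I.
  apply/imsetP => -[[a b]]; rewrite inE /= => /andP[lt_ab _] [ia jb].
  by move: lt_ab; rewrite -[a](tpermK i j) -ia -[b](tpermK i j) -jb tpermL tpermR; lia.
transitivity #|(i, j) |: f @: I|; last by rewrite cardsU1 notI card_imset.
apply: eq_card => -[a b]; rewrite !inE /= !permM xpair_eqE.
case: (boolP ((a == i) && (b == j))) => [/andP[/eqP -> /eqP ->]|ne_ij] /=.
  by rewrite tpermL tpermR lt_w ji ltnSn.
case: (boolP ((a == j) && (b == i))) => [/andP[/eqP -> /eqP ->]|ne_ji] /=.
  rewrite ltnNge ji leqnSn /=; apply/esym/imsetP => -[[c d]].
  rewrite inE /= => /andP[lt_cd lt_w'] [cj di]; move: lt_w'.
  by rewrite -[c](tpermK i j) -cj -[d](tpermK i j) -di tpermL tpermR; lia.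
rewrite -(ltn_tperm ji ne_ij ne_ji).
apply/idP/imsetP => [h|[[c d]]].
  by exists (tperm i j a, tperm i j b); rewrite ?inE // /f /= !tpermK.
by rewrite inE /= => h [-> ->]; rewrite !tpermK.
Qed.

(** Each of the two factors changes the length by exactly one, so that the length is kept iff one of
    them raises it and the other lowers it. The right factor is treated as a left factor of the
    inverse. The two excluded cases are those in which the first factor disturbs the comparison that
    governs the second. *)
Lemma coxlen_conj n (i j : 'I_n) (w : 'S_n) : j = i.+1 :> nat ->
    ~~ ((w i == i) && (w j == j)) -> ~~ ((w i == j) && (w j == i)) ->
  (coxlen (tperm i j * w * tperm i j) == coxlen w)
    = (w i < w j) (+) (w^-1 i < w^-1 j)%g.
Proof.
move=> ji nfix nswap.
have key (u : 'S_n) : if u i < u j then coxlen (tperm i j * u) = (coxlen u).+1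
    else coxlen u = (coxlen (tperm i j * u)).+1.
  case: ltnP => [|le_u]; first exact: coxlen_tpermM.
  have ne_u : u j != u i :> nat by rewrite val_eqE (inj_eq perm_inj) -val_eqE /=; lia.
  rewrite -{1}(mulKg (tperm i j) u) tpermV; apply: coxlen_tpermM => //.
  by rewrite !permM tpermL tpermR; lia.
set t := tperm i j; set w' := (t * w)%g.
have -> : (t * w * t = (t * w'^-1)^-1)%g by rewrite invMg invgK tpermV.
rewrite coxlenV.
have := key w; have := key w'^-1%g; rewrite coxlenV -/t -/w'.
have -> : (w'^-1 i < w'^-1 j)%g = (w^-1 i < w^-1 j)%g.
  rewrite invMg tpermV !permM ltn_tperm //.
    by apply: contra nfix => /andP[/eqP hi /eqP hj]; rewrite !(canF_eq (permK w)) hi hj !eqxx.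
  by apply: contra nswap => /andP[/eqP hi /eqP hj]; rewrite !(canF_eq (permK w)) hi hj !eqxx.
by case: (w i < w j); case: (_ < _) => /=; lia.
Qed.

(** * Cyclic lists encoded by words *)

(** The nested defaults of [head] express the wrap-around: if [s2] is empty, the successor is the
    first entry of the list, which is [x] itself when [s1] is empty too. *)
Lemma next_cat (T : eqType) (s1 : seq T) x s2 : uniq (s1 ++ x :: s2) ->
  next (s1 ++ x :: s2) x = head (head x s1) s2.
Proof.
move=> Us; rewrite -(next_rot (size s1) Us) rot_size_cat next_nth mem_head /= eqxx.
by case: s2 {Us} => //=; case: s1.
Qed.

Lemma prev_cat (T : eqType) (s1 : seq T) x s2 : uniq (s1 ++ x :: s2) ->
  prev (s1 ++ x :: s2) x = last (last x s2) s1.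
Proof.
have head_rev (y : T) s : head y (rev s) = last y s.
  by case/lastP: s => // s z; rewrite rev_rcons last_rcons.
move=> Us; rewrite -(next_rev Us) rev_cat rev_cons cat_rcons next_cat ?head_rev ?head_rev //.
by rewrite -cat_rcons -rev_cons -rev_cat rev_uniq.
Qed.

(* A word lists its letters from the outermost pair of values to the innermost
   one. Values are those of ['I_n], i.e. one less than in the header. *)
Inductive letter := L | R | D.

(* The low ([x = true]) and the high value of the [j]-th pair from the middle. *)
Definition lab n (x : bool) j := if x then n./2 - j.+1 else n - n./2 + j.

(* Whether the list encoded by [w] is to be preceded by a high value and
   followed by a low one; for odd [n], [tau] says this of the middle value. *)
Fixpoint ori (tau : bool) w :=
  match w with
  | [::] => tau
  | D :: w' => ~~ ori tau w'
  | _ :: w' => ori tau w'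
  end.

(** Here [o] is the orientation of the arc [s] in the sense of [ori]. It forces the order of the two
    new values, so that only their sides are left to the letter. *)
Definition add_pair n a o j s :=
  match a with
  | L => lab n o j :: lab n (~~ o) j :: s
  | R => s ++ [:: lab n o j; lab n (~~ o) j]
  | D => lab n (~~ o) j :: s ++ [:: lab n o j]
  end.

Fixpoint build n tau w :=
  match w with
  | [::] => if odd n then [:: n./2] else [::]
  | a :: w' => add_pair n a (ori tau w') (size w') (build n tau w')
  end.

Section Build.

Variable n : nat.
Implicit Types (tau o : bool) (p w : seq letter).

Lemma size_build tau w : size (build n tau w) = odd n + (size w).*2.
Proof.
elim: w => [|a w IHw] /=; first by case: odd.
by case: a; rewrite /= ?size_cat /= IHw; lia.
Qed.

Lemma mem_build tau w y : size w <= n./2 ->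
  (y \in build n tau w) = (n./2 - size w <= y < n - n./2 + size w).
Proof.
elim: w => [|a w IHw] /= lt_w.
  by case: ifP => odd_n; rewrite ?inE ?in_nil; lia.
by case: a; rewrite /= !(inE, mem_cat) (IHw (ltnW lt_w)) /lab; case: (ori tau w) => /=; lia.
Qed.

Lemma build_uniq tau w : size w <= n./2 -> uniq (build n tau w).
Proof.
elim: w => [|a w IHw] /= lt_w; first by case: ifP.
have le_w := ltnW lt_w; have {IHw} Uw := IHw le_w.
have out x : lab n x (size w) \notin build n tau w.
  by rewrite mem_build // /lab; case: x; lia.
have neq : lab n (ori tau w) (size w) != lab n (~~ ori tau w) (size w).
  by rewrite /lab; case: ori => /=; lia.
case: a => /=; rewrite ?cat_uniq /= ?mem_cat !inE ?negb_or ?Uw ?(negbTE (out _)) ?orbF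
  ?andbT ?neq ?out //=.
by rewrite eq_sym.
Qed.

Lemma lab_mem tau w x j : size w <= n./2 -> j < size w -> lab n x j \in build n tau w.
Proof. by move=> le_w lt_j; rewrite mem_build // /lab; case: x; lia. Qed.

Lemma perm_build tau w : size w = n./2 -> perm_eq (build n tau w) (iota 0 n).
Proof.
move=> sz_w; apply: uniq_perm; rewrite ?iota_uniq ?build_uniq ?sz_w //.
by move=> y; rewrite mem_build ?sz_w // mem_iota; lia.
Qed.

Definition swap_ori := [fun a => match a with L => R | R => L | D => D end].

Lemma ori_swap tau w : ori (~~ tau) (map swap_ori w) = ~~ ori tau w.
Proof. by elim: w => [|[] w /= ->]. Qed.

(** Reversal exchanges the two sides, hence L and R, and also what precedes with what follows, hence
    the orientation. It will represent the passage to the inverse cycle. *)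
Lemma rev_build tau w :
  rev (build n tau w) = build n (~~ tau) (map swap_ori w).
Proof.
elim: w => [|a w IHw] /=; first by case: ifP.
rewrite ori_swap size_map -IHw.
by case: a; rewrite /= ?rev_cons ?rev_cat /= ?negbK -?cats1 -?catA.
Qed.

(** The outermost pair closes up the cyclic list, so its letter only affects where the list is
    cut. *)
Lemma build_outer a b tau w :
  exists s1 s2, build n tau (a :: w) = s1 ++ s2 /\ build n tau (b :: w) = s2 ++ s1.
Proof.
rewrite /=; set s := build n tau w.
pose k := lab n (ori tau w) (size w); pose k' := lab n (~~ ori tau w) (size w).
case: a; case: b; rewrite /= -/k -/k'.
- by exists [::], [:: k, k' & s]; rewrite cats0.
- by exists [:: k; k'], s.
- by exists [:: k], (k' :: s).
- by exists s, [:: k; k'].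
- by exists [::], (s ++ [:: k; k']); rewrite cats0.
- by exists (s ++ [:: k]), [:: k']; rewrite -catA.
- by exists (k' :: s), [:: k].
- by exists [:: k'], (s ++ [:: k]); rewrite -catA.
by exists [::], (k' :: s ++ [:: k]); rewrite cats0.
Qed.

(** Outer letters see the inner word only through its orientation and its size. Hence an inner
    factor can be rewritten without disturbing what surrounds it. *)
Lemma build_context p o j : exists u v, forall tau w,
  ori tau w = o -> size w = j -> build n tau (p ++ w) = u ++ build n tau w ++ v.
Proof.
elim: p => [|a p [u [v IHp]]] /=; first by exists [::], [::] => tau w _ _; rewrite cats0.
pose o' := ori o p.
have oriE tau w : ori tau w = o -> ori tau (p ++ w) = o'.
  by rewrite /o' => <-; elim: (p) => [|[] q /= ->].
case: a.
- exists [:: lab n o' (size p + j), lab n (~~ o') (size p + j) & u], v => tau w ow sw.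
  by rewrite /= oriE // IHp // size_cat sw.
- exists u, (v ++ [:: lab n o' (size p + j); lab n (~~ o') (size p + j)]) => tau w ow sw.
  by rewrite /= oriE // IHp // size_cat sw -!catA.
exists (lab n (~~ o') (size p + j) :: u), (v ++ [:: lab n o' (size p + j)]) => tau w ow sw.
by rewrite /= oriE // IHp // size_cat sw -!catA.
Qed.

(* The [m] such that the encoded cycle maps [1, m] onto [n-m+1, n]. *)
Definition mid tau := if tau then n./2 else n - n./2.

(** The oscillation condition for [m], stated for an entry [y] and its successor [z]. *)
Definition alt m (y z : nat) := (y < m) == (n - m <= z).

Lemma lab_mid tau x j : j < n./2 ->
  ((lab n x j < mid tau) = x) * ((n - mid tau <= lab n x j) = ~~ x).
Proof. by rewrite /lab /mid => lt_j; case: x; case: tau => /=; split; lia. Qed.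

(** The neighbours [y] and [z] are arbitrary values on the right sides, so that in the induction the
    newly added pair can play their role. *)
Lemma path_build tau w y z : size w <= n./2 ->
    (y < mid tau) = ~~ ori tau w -> (n - mid tau <= z) = ~~ ori tau w ->
  path (alt (mid tau)) y (rcons (build n tau w) z).
Proof.
elim: w y z => [|a w IHw] y z /=.
  by move=> _; case: ifP => odd_n /=; rewrite /alt /mid; case: tau => /=; lia.
move=> lt_w; have le_w := ltnW lt_w.
have catE y' s x l : path (alt (mid tau)) y' (s ++ x :: l)
    = path (alt (mid tau)) y' (rcons s x) && path (alt (mid tau)) x l.
  by rewrite -cat_rcons cat_path last_rcons.
case: a => /=; rewrite ?negbK => hy hz.
- by rewrite IHw ?lab_mid ?negbK // /alt !lab_mid // hy negbK !eqxx.
- by rewrite rcons_cat catE IHw ?lab_mid //= /alt !lab_mid // hz negbK !eqxx.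
by rewrite rcons_cat catE IHw ?lab_mid ?negbK //= /alt !lab_mid // hy hz negbK !eqxx.
Qed.

Lemma last_build tau w d : size w <= n./2 ->
  (last d (build n tau w) = d /\ size (build n tau w) = 0)
    \/ n./2 - size w <= last d (build n tau w) < n - n./2 + size w.
Proof.
move=> le_w; case def_s: (build n tau w) => [|b s]; [by left | right].
by rewrite -(mem_build tau) // def_s /= mem_last.
Qed.

Lemma head_build tau w d : size w <= n./2 ->
  (head d (build n tau w) = d /\ size (build n tau w) = 0)
    \/ n./2 - size w <= head d (build n tau w) < n - n./2 + size w.
Proof.
move=> le_w; case def_s: (build n tau w) => [|b s]; [by left | right].
by rewrite -(mem_build tau) // def_s /= mem_head.
Qed.

End Build.

Lemma mid_gt0 n tau : 1 < n -> 0 < mid n tau.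
Proof. by rewrite /mid; case: tau; lia. Qed.

Lemma build_ends n tau w x s : 1 < n -> size w <= n./2 -> build n tau w = x :: s ->
  (n - mid n tau <= x) = ~~ ori tau w /\ (last x s < mid n tau) = ~~ ori tau w.
Proof.
move=> n_gt1 le_w def_s.
(* Dummy neighbours on the sides required by [path_build]; only their position relative to the two
   thresholds matters. *)
pose y := if ori tau w then mid n tau else 0.
pose z := if ori tau w then 0 else n.
have hy : (y < mid n tau) = ~~ ori tau w.
  by rewrite /y; case: ori; rewrite ?ltnn ?mid_gt0.
have hz : (n - mid n tau <= z) = ~~ ori tau w.
  by rewrite /z /mid; case: ori; case: (tau) => /=; lia.
have := path_build le_w hy hz; rewrite def_s /= rcons_path /alt hy hz.
by case/andP=> /eqP -> /andP[_ /eqP ->].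
Qed.

Lemma cycle_build n tau w : 1 < n -> size w <= n./2 ->
  path.cycle (alt n (mid n tau)) (build n tau w).
Proof.
move=> n_gt1 le_w; case def_s: (build n tau w) => [|x s] //=.
have [hx _] := build_ends n_gt1 le_w def_s.
pose y := if ori tau w then mid n tau else 0.
have hy : (y < mid n tau) = ~~ ori tau w.
  by rewrite /y; case: ori; rewrite ?ltnn ?mid_gt0.
by have := path_build le_w hy hx; rewrite def_s /= => /andP[].
Qed.

Definition outside n (o : bool) j y := if o then y < n./2 - j else n - n./2 + j <= y.

(** The inner arc fills an interval of values, so its two neighbours lie beyond that interval;
    alternation along the cycle tells on which side. *)
Lemma context_outside n tau (p w : seq letter) u v d :
    1 < n -> size (p ++ w) <= n./2 -> 0 < size p -> build n tau w != [::] ->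
    build n tau (p ++ w) = u ++ build n tau w ++ v ->
  outside n (ori tau w) (size w) (head d (v ++ u))
  /\ outside n (~~ ori tau w) (size w) (last d (v ++ u)).
Proof.
move=> n_gt1 le_pw sz_p B_n0 def_s.
have le_w : size w <= n./2 by move: le_pw; rewrite size_cat; lia.
have := cycle_build tau n_gt1 le_pw; have := build_uniq tau le_pw.
have := size_build n tau (p ++ w); rewrite def_s -(rot_uniq (size u)) -(rot_cycle (size u)).
rewrite rot_size_cat -catA !size_cat size_build.
case def_t: (v ++ u) => [|c t]; first by move/(congr1 size): def_t; rewrite size_cat /=; lia.
move=> _; case def_B: (build n tau w) B_n0 => [|b B] // _.
have [hb hB] := build_ends n_gt1 le_w def_B.
rewrite cat_uniq => /and3P[_ /hasPn out _].
rewrite /= rcons_cat cat_path /= rcons_path => /and4P[_ /eqP Bc _ /eqP cB].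
have notB y : y \in c :: t -> ~~ (n./2 - size w <= y < n - n./2 + size w).
  by move/out; rewrite /= -def_B mem_build.
have := notB c (mem_head _ _); have := notB (last c t) (mem_last _ _).
rewrite hB in Bc; rewrite hb in cB; rewrite /outside.
move: Bc cB; rewrite /mid; case: ori; case: (tau) => /=; lia.
Qed.

(** * Cycles represented by lists of natural numbers *)

Section Representation.

Variable n : nat.
Implicit Types (sigma : 'S_n) (s : seq nat).

Definition cyc_repr sigma s := perm_eq s (iota 0 n) /\ forall i : 'I_n, next s i = sigma i.

Lemma cyc_repr_uniq sigma s : cyc_repr sigma s -> uniq s.
Proof. by case=> /perm_uniq ->; rewrite iota_uniq. Qed.

Lemma cyc_repr_size sigma s : cyc_repr sigma s -> size s = n.
Proof. by case=> /perm_size ->; rewrite size_iota. Qed.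

Lemma mem_cyc_repr sigma s y : cyc_repr sigma s -> (y \in s) = (y < n).
Proof. by case=> /perm_mem ->; rewrite mem_iota. Qed.

Lemma cyc_repr_inj sigma sigma' s : cyc_repr sigma s -> cyc_repr sigma' s -> sigma = sigma'.
Proof. by move=> [_ r] [_ r']; apply/permP => i; apply: val_inj; rewrite /= -r -r'. Qed.

Lemma cyc_repr_rot sigma s1 s2 : cyc_repr sigma (s1 ++ s2) -> cyc_repr sigma (s2 ++ s1).
Proof.
move=> rs; split; first by rewrite perm_catC; case: rs.
by move=> i; rewrite -rot_size_cat next_rot ?(cyc_repr_uniq rs) //; case: rs.
Qed.

Lemma cyc_repr_prev sigma s (i : 'I_n) : cyc_repr sigma s -> prev s i = (sigma^-1 i)%g.
Proof.
move=> rs; have [_ nx] := rs; rewrite -{1}(permKV sigma i) -nx prev_next //.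
exact: cyc_repr_uniq rs.
Qed.

Lemma cyc_repr_rev sigma s : cyc_repr sigma s -> cyc_repr sigma^-1%g (rev s).
Proof.
move=> rs; split; first by rewrite perm_rev; case: rs.
by move=> i; rewrite next_rev ?(cyc_repr_uniq rs) // (cyc_repr_prev _ rs).
Qed.

Definition swapn (a b y : nat) := if y == a then b else if y == b then a else y.

Lemma swapnK a b : involutive (swapn a b).
Proof. by move=> y; rewrite /swapn; do !case: eqP => //; lia. Qed.

Lemma swapn_id a b s : a \notin s -> b \notin s -> map (swapn a b) s = s.
Proof.
move=> a_s b_s; apply: map_id_in => y ys; rewrite /swapn.
by case: eqP => [ya|_]; [rewrite -ya ys in a_s | case: eqP => // yb; rewrite -yb ys in b_s].
Qed.

Lemma val_tperm (i j k : 'I_n) : tperm i j k = swapn i j k :> nat.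
Proof. by rewrite permE /= /swapn -!val_eqE /=; do !case: ifP. Qed.

Lemma cyc_repr_tperm sigma s (i j : 'I_n) :
  cyc_repr sigma s -> cyc_repr (tperm i j * sigma * tperm i j)%g (map (swapn i j) s).
Proof.
move=> rs; have swI := inv_inj (@swapnK i j).
split.
  apply: uniq_perm; rewrite ?iota_uniq ?(map_inj_uniq swI) ?(cyc_repr_uniq rs) // => y.
  rewrite -{1}(swapnK i j y) (mem_map swI) (mem_cyc_repr _ rs) mem_iota /swapn.
  by have := ltn_ord i; have := ltn_ord j; do !case: eqP; lia.
move=> k; rewrite !permM val_tperm -{1}(tpermK i j k) val_tperm.
by rewrite (next_map swI) ?(cyc_repr_uniq rs) //; case: rs => _ ->.
Qed.

Lemma cyc_repr_cons sigma s (i : 'I_n) : cyc_repr sigma s -> exists l, cyc_repr sigma (val i :: l).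
Proof.
move=> rs; have s_i : val i \in s by rewrite (mem_cyc_repr _ rs) ltn_ord.
by case/splitPr: s_i rs => s1 s2 /cyc_repr_rot rs; exists (s2 ++ s1).
Qed.

Lemma cyc_repr_not_fixed sigma s (i : 'I_n) : 1 < n -> cyc_repr sigma s -> sigma i != i.
Proof.
move=> n_gt1 /(cyc_repr_cons i)[l rl]; have Ul := cyc_repr_uniq rl.
have /= sl := cyc_repr_size rl; have [_ nx] := rl.
rewrite -val_eqE /= -nx (@next_cat _ [::]) //=.
case: l Ul sl {rl nx} => [|y l] /=; first lia.
by rewrite inE negb_or eq_sym => /andP[/andP[]].
Qed.

Lemma cyc_repr_not_swapped sigma s (i j : 'I_n) :
  2 < n -> cyc_repr sigma s -> ~~ ((sigma i == j) && (sigma j == i)).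
Proof.
move=> n_gt2 rs; apply/andP=> -[/eqP ij /eqP ji].
have [l rl] := cyc_repr_cons i rs; have Ul := cyc_repr_uniq rl.
have /= sl := cyc_repr_size rl; have [_ nx] := rl.
have := nx i; rewrite (@next_cat _ [::]) //= ij.
case: l Ul sl rl nx => [|y [|z l]] /= Ul sl rl nx; try lia.
move=> yj; have := nx j; rewrite -yj ji eqxx.
move: Ul; rewrite !inE !negb_or eq_sym => /andP[/and3P[/negbTE -> /eqP iz _] _] zi.
exact: iz (esym zi).
Qed.

(** The criterion of [coxlen_conj], read off from the neighbours in the list. *)
Definition flip s a b := (next s a < next s b) (+) (prev s a < prev s b).

Lemma coxlen_flip sigma s (i j : 'I_n) : 2 < n -> cyc_repr sigma s -> j = i.+1 :> nat ->
  (coxlen (tperm i j * sigma * tperm i j) == coxlen sigma) = flip s i j.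
Proof.
move=> n_gt2 rs ji; rewrite coxlen_conj ?(cyc_repr_not_swapped _ _ _ rs) //.
  by rewrite /flip !(cyc_repr_prev _ rs); case: (rs) => _ nx; rewrite !nx.
by rewrite (negbTE (cyc_repr_not_fixed _ _ rs)) // ltnW.
Qed.

Lemma flip_eq sigma s s' (i j : 'I_n) :
  cyc_repr sigma s -> cyc_repr sigma s' -> flip s i j = flip s' i j.
Proof.
move=> rs rs'; rewrite /flip !(cyc_repr_prev _ rs) !(cyc_repr_prev _ rs').
by case: rs rs' => _ nx [_ nx']; rewrite !nx !nx'.
Qed.

Lemma flip_sym sigma s (i j : 'I_n) : cyc_repr sigma s -> i != j -> flip s i j = flip s j i.
Proof.
move=> rs neq_ij; have [_ nx] := rs; rewrite /flip !(cyc_repr_prev _ rs) !nx.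
have: sigma i != sigma j :> nat by rewrite val_eqE (inj_eq perm_inj).
have: (sigma^-1 i)%g != (sigma^-1 j)%g :> nat by rewrite val_eqE (inj_eq perm_inj).
by lia.
Qed.

End Representation.

(** * Length-preserving conjugations preserve the encoding *)

(** Once the list is split at each of the two values, [flip] only involves first and last entries;
    the explicit splittings below serve this purpose. *)
Lemma flip_cat l A1 x A2 B1 y B2 : uniq l -> l = A1 ++ x :: A2 -> l = B1 ++ y :: B2 ->
  flip l x y = (head (head x A1) A2 < head (head y B1) B2)
               (+) (last (last x A2) A1 < last (last y B2) B1).
Proof.
by move=> Ul lA lB; rewrite /flip lA next_cat ?prev_cat -?lA // lB next_cat ?prev_cat -?lB.
Qed.

Section Swaps.

Variable n : nat.
Implicit Types (sigma : 'S_n) (tau o : bool) (p w : seq letter).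

Definition arc_perm sigma :=
  exists tau w, size w = n./2 /\ cyc_repr sigma (build n tau w).

Lemma swapn_build tau w x1 x2 j1 j2 :
    size w <= j1 < n./2 -> size w <= j2 < n./2 ->
  [seq swapn (lab n x1 j1) (lab n x2 j2) y | y <- build n tau w] = build n tau w.
Proof.
by move=> lt1 lt2; apply: swapn_id; rewrite mem_build /lab; case: x1; case: x2; lia.
Qed.

(** This lemma and the next two realize RL <-> DD, DL <-> LD and LR <-> DD by exchanging values of
    consecutive pairs: on side [ori tau w] in the first two, on the opposite side in the third. *)
Lemma swapn_RL tau w : (size w).+1 < n./2 ->
  [seq swapn (lab n (ori tau w) (size w)) (lab n (ori tau w) (size w).+1) y
     | y <- build n tau [:: R, L & w]] = build n tau [:: D, D & w].
Proof.
move=> lt_w; rewrite /= negbK map_cat /= swapn_build; try lia.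
by rewrite /swapn /lab; case: (ori tau w) => /=; repeat case: eqP; move=> *; rewrite -?catA //; lia.
Qed.

Lemma swapn_DL tau w : (size w).+1 < n./2 ->
  [seq swapn (lab n (ori tau w) (size w)) (lab n (ori tau w) (size w).+1) y
     | y <- build n tau [:: D, L & w]] = build n tau [:: L, D & w].
Proof.
move=> lt_w; rewrite /= negbK map_cat /= swapn_build; try lia.
by rewrite /swapn /lab; case: (ori tau w) => /=; repeat case: eqP; move=> *; rewrite -?catA //; lia.
Qed.

Lemma swapn_LR tau w : (size w).+1 < n./2 ->
  [seq swapn (lab n (~~ ori tau w) (size w)) (lab n (~~ ori tau w) (size w).+1) y
     | y <- build n tau [:: L, R & w]] = build n tau [:: D, D & w].
Proof.
move=> lt_w; rewrite /= negbK !map_cat /= swapn_build; try lia.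
by rewrite /swapn /lab; case: (ori tau w) => /=; repeat case: eqP; move=> *; rewrite -?catA //; lia.
Qed.

Lemma swap_context sigma tau tau' p w w' (i j : 'I_n) :
    size (p ++ w) = n./2 -> cyc_repr sigma (build n tau (p ++ w)) ->
    ori tau' w' = ori tau w -> size w' = size w ->
    (i : nat) \in build n tau w -> (j : nat) \in build n tau w ->
    map (swapn i j) (build n tau w) = build n tau' w' ->
  cyc_repr (tperm i j * sigma * tperm i j)%g (build n tau' (p ++ w')).
Proof.
move=> sz_pw rs oE sE iB jB mapE.
have [u [v ctx]] := build_context n p (ori tau w) (size w).
have := cyc_repr_uniq rs; have := cyc_repr_tperm i j rs.
rewrite !ctx // !map_cat mapE !cat_uniq => rs' /and3P[_ /hasPn Bu /and3P[_ /hasPn vB _]].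
rewrite !swapn_id // in rs'.
- by apply/negP => /vB; rewrite iB.
- by apply/negP => /vB; rewrite jB.
- by apply: Bu; rewrite mem_cat iB.
by apply: Bu; rewrite mem_cat jB.
Qed.

(** The list is rotated so that the arc of [w] comes first; [t] collects the values added by the
    outer letters [p]. *)
Lemma context_cycle sigma tau p w : 1 < n -> size (p ++ w) = n./2 ->
    build n tau w != [::] -> cyc_repr sigma (build n tau (p ++ w)) ->
  exists t, [/\ cyc_repr sigma (build n tau w ++ t), size p = 0 -> t = [::]
    & forall d, 0 < size p -> outside n (ori tau w) (size w) (head d t)
                           /\ outside n (~~ ori tau w) (size w) (last d t)].
Proof.
move=> n_gt1 sz_w w_n0; have [u [v ctx]] := build_context n p (ori tau w) (size w).
have {}ctx := ctx tau w erefl erefl; rewrite ctx => rs; exists (v ++ u); split.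
- by rewrite catA; apply: cyc_repr_rot rs.
- move=> p0; apply/nilP; rewrite /nilp size_cat; move: ctx; rewrite (size0nil p0).
  by move/(congr1 size); rewrite !size_cat /=; lia.
by move=> d p_gt0; apply: context_outside ctx; rewrite ?sz_w.
Qed.

(* Patterns in which exchanging the two values on side [ori] changes the length.
   The conditions leave out the words that can be rewritten first: an outermost
   letter is free, and an innermost R is an L when [s0] is empty. *)
Definition rigid (p : seq letter) a2 a1 (s0 : seq nat) :=
  match a2, a1 with
  | L, L | L, R | R, D => 0 < size p
  | R, R | D, R => 0 < size s0
  | _, _ => false
  end.

(** In each pattern the two successors compare in the same way as the two predecessors. A neighbour
    that is not one of the four values added by [a2] and [a1] lies either in the arc of [w] or
    beyond these values, which suffices to compare it. *)
Lemma flip_rigid sigma tau p a2 a1 w (i j : 'I_n) :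
    size (p ++ [:: a2, a1 & w]) = n./2 -> cyc_repr sigma (build n tau (p ++ [:: a2, a1 & w])) ->
    i = lab n (ori tau w) (size w) :> nat -> j = lab n (ori tau w) (size w).+1 :> nat ->
    rigid p a2 a1 (build n tau w) ->
  flip (build n tau (p ++ [:: a2, a1 & w])) i j = false.
Proof.
move=> sz_w rs def_i def_j.
have n_gt1 : 1 < n by move: sz_w; rewrite size_cat /=; lia.
have B_n0 : build n tau [:: a2, a1 & w] != [::] by rewrite -size_eq0 size_build /=; lia.
have le_w : size w <= n./2 by move: sz_w; rewrite size_cat /=; lia.
have [t [rs' t0 out]] := context_cycle n_gt1 sz_w B_n0 rs.
have ins d := last_build tau d le_w.
rewrite (flip_eq _ _ rs rs') {rs B_n0}; have {rs'} Us := cyc_repr_uniq rs'.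
rewrite /flip def_i def_j -/(flip _ _ _); move: sz_w; rewrite size_cat /=.
pose k := lab n (ori tau w) (size w); pose k1 := lab n (ori tau w) (size w).+1.
pose k' := lab n (~~ ori tau w) (size w); pose k1' := lab n (~~ ori tau w) (size w).+1.
move: Us out; case: a2; case: a1 => //=; rewrite ?negbK -/k -/k1 -/k' -/k1'.
all: move: (build n tau w) ins => s ins; rewrite -?catA /= => Us out sz_w rigid_w.
(* The remaining cases are LL, LR, RR, RD and DR, in this order. *)
- rewrite (@flip_cat _ [:: k1; k1'] k (k' :: s ++ t) [::] k1 [:: k1', k, k' & s ++ t]) //=.
  have := out (last k' s) rigid_w; rewrite last_cat.
  by rewrite /outside /k /k1 /k' /k1' /lab; case: ori => /=; lia.
- rewrite (@flip_cat _ [:: k1, k1' & s] k (k' :: t) [::] k1 (k1' :: s ++ [:: k, k' & t]))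
    /= -?catA //=.
  rewrite !last_cat /=; have := out k' rigid_w; have := ins k1'.
  by rewrite /outside /k /k1 /k' /k1' /lab; case: ori => /=; lia.
- rewrite (@flip_cat _ s k [:: k', k1, k1' & t] (s ++ [:: k; k']) k1 (k1' :: t)) /= -?catA //=.
  rewrite !last_cat /=; have := ins (last k1' t).
  by rewrite /outside /k /k1 /k' /k1' /lab; case: ori => /=; lia.
- rewrite (@flip_cat _ (k' :: s) k [:: k1', k1 & t] (k' :: s ++ [:: k; k1']) k1 t) /= -?catA //=.
  rewrite !last_cat /=; have := ins k'; have := out k' rigid_w.
  by rewrite /outside /k /k1 /k' /k1' /lab; case: ori => /=; lia.
rewrite (@flip_cat _ (k1' :: s) k [:: k', k1 & t] (k1' :: s ++ [:: k; k']) k1 t) /= -?catA //=.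
rewrite !last_cat /=; have := ins k1'; have := out k1'.
(* DR is rigid even without outer letters; then [t] is empty and the neighbours wrap around. *)
case: (posnP (size p)) => [/t0 -> _|p_gt0 /(_ isT)].
all: by rewrite /outside /k /k1 /k' /k1' /lab; case: ori => /=; lia.
Qed.

End Swaps.

Section Steps.

Variable n : nat.
Implicit Types (sigma : 'S_n) (tau o : bool) (p w : seq letter).

Definition movable a2 a1 :=
  match a2, a1 with R, L | D, D | D, L | L, D => true | _, _ => false end.

Lemma movable_step sigma tau p a2 a1 w (i j : 'I_n) :
    size (p ++ [:: a2, a1 & w]) = n./2 -> cyc_repr sigma (build n tau (p ++ [:: a2, a1 & w])) ->
    i = lab n (ori tau w) (size w) :> nat -> j = lab n (ori tau w) (size w).+1 :> nat ->
  movable a2 a1 -> arc_perm (tperm i j * sigma * tperm i j)%g.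
Proof.
move=> sz_w rs def_i def_j mv.
have lt_w : (size w).+1 < n./2 by move: sz_w; rewrite size_cat /=; lia.
have iB b2 b1 : (i : nat) \in build n tau [:: b2, b1 & w] by rewrite def_i lab_mem /=; lia.
have jB b2 b1 : (j : nat) \in build n tau [:: b2, b1 & w] by rewrite def_j lab_mem /=; lia.
have inv b2 b1 c2 c1 :
    map (swapn i j) (build n tau [:: b2, b1 & w]) = build n tau [:: c2, c1 & w] ->
    map (swapn i j) (build n tau [:: c2, c1 & w]) = build n tau [:: b2, b1 & w].
  by move=> <-; rewrite (mapK (swapnK i j)).
have key b2 b1 : ori tau [:: b2, b1 & w] = ori tau [:: a2, a1 & w] ->
    map (swapn i j) (build n tau [:: a2, a1 & w]) = build n tau [:: b2, b1 & w] ->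
    arc_perm (tperm i j * sigma * tperm i j)%g.
  move=> oE mapE; exists tau, (p ++ [:: b2, b1 & w]); split; first by rewrite -sz_w !size_cat.
  exact: (swap_context sz_w rs oE).
have mRL := swapn_RL tau lt_w; have mDL := swapn_DL tau lt_w; rewrite -def_i -def_j in mRL mDL.
case: a2 a1 mv sz_w rs key => [] [] // _ _ _ key.
- by apply: (key D L) => //; apply: inv mDL.
- by apply: (key D D) mRL; rewrite /= negbK.
- by apply: (key L D) mDL.
by apply: (key R L); [rewrite /= negbK | apply: inv mRL].
Qed.

(** Four of the nine letter pairs are movable. For the other five, [flip] rules out rigidity, so
    that the outer letter is outermost or the arc of [w] is empty; replacing the letter that is then
    free yields a movable pair. *)
Lemma pair_step sigma tau p a2 a1 w (i j : 'I_n) :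
    size (p ++ [:: a2, a1 & w]) = n./2 -> cyc_repr sigma (build n tau (p ++ [:: a2, a1 & w])) ->
    i = lab n (ori tau w) (size w) :> nat -> j = lab n (ori tau w) (size w).+1 :> nat ->
    flip (build n tau (p ++ [:: a2, a1 & w])) i j ->
  arc_perm (tperm i j * sigma * tperm i j)%g.
Proof.
move=> sz_w rs def_i def_j fl.
have go b2 b1 : size (p ++ [:: b2, b1 & w]) = n./2 /\
    (cyc_repr sigma (build n tau (p ++ [:: b2, b1 & w])) -> movable b2 b1 ->
    arc_perm (tperm i j * sigma * tperm i j)%g).
  by split=> [|rs' mv]; [|apply: (movable_step _ rs' def_i def_j mv)]; rewrite -sz_w !size_cat.
have inner b2 : build n tau w = [::] ->
    build n tau (p ++ [:: b2, R & w]) = build n tau (p ++ [:: b2, L & w]).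
  move=> w0; have [u [v ctx]] := build_context n p (ori tau [:: b2, L & w]) (size w).+2.
  by rewrite !ctx //=; case: (b2) => /=; rewrite w0.
have outer b2 b1 c2 : p = [::] -> cyc_repr sigma (build n tau (p ++ [:: b2, b1 & w])) ->
    cyc_repr sigma (build n tau (p ++ [:: c2, b1 & w])).
  move=> -> /=; have [s1 [s2 [e1 e2]]] := build_outer n b2 c2 tau (b1 :: w).
  by move: e1 e2 => /= -> -> /cyc_repr_rot.
have not_rigid b2 b1 : cyc_repr sigma (build n tau (p ++ [:: b2, b1 & w])) ->
    rigid p b2 b1 (build n tau w) = false.
  move=> rs'; apply/negP => rg.
  have := flip_rigid (go b2 b1).1 rs' def_i def_j rg.
  by rewrite -(flip_eq _ _ rs rs') fl.
have p0 b2 b1 : cyc_repr sigma (build n tau (p ++ [:: b2, b1 & w])) ->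
    rigid p b2 b1 (build n tau w) = (0 < size p) -> p = [::].
  by move=> /not_rigid -> /esym/negbT; rewrite -eqn0Ngt => /nilP.
have s0 b2 b1 : cyc_repr sigma (build n tau (p ++ [:: b2, b1 & w])) ->
    rigid p b2 b1 (build n tau w) = (0 < size (build n tau w)) -> build n tau w = [::].
  by move=> /not_rigid -> /esym/negbT; rewrite -eqn0Ngt => /nilP.
have goRR : cyc_repr sigma (build n tau (p ++ [:: R, R & w])) ->
    arc_perm (tperm i j * sigma * tperm i j)%g.
  by move=> rs'; apply: (go R L).2 => //; rewrite -inner // (s0 R R).
case: a2 a1 sz_w rs fl => [] [] _ rs fl.
- by apply: (go R L).2 => //; apply: (outer L _ _ (p0 _ _ rs _) rs).
(* LR needs both replacements: it is first read as RR and then as RL. *)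
- by apply: goRR; apply: (outer L _ _ (p0 _ _ rs _) rs).
- exact: (go L D).2.
- exact: (go R L).2.
- exact: goRR.
- by apply: (go D D).2 => //; apply: (outer R _ _ (p0 _ _ rs _) rs).
- exact: (go D L).2.
- by apply: (go D L).2 => //; rewrite -inner // (s0 D R).
exact: (go D D).2.
Qed.

Lemma cyc_repr_inv_build sigma tau w : cyc_repr sigma (build n tau w) ->
  cyc_repr sigma^-1%g (build n (~~ tau) (map swap_ori w)).
Proof. by move/cyc_repr_rev; rewrite rev_build. Qed.

Lemma arc_permV sigma : arc_perm sigma^-1%g -> arc_perm sigma.
Proof.
move=> [tau [w [sz_w /cyc_repr_inv_build]]]; rewrite invgK => rs.
by exists (~~ tau), (map swap_ori w); rewrite size_map.
Qed.

Lemma arc_perm_conjV sigma (i j : 'I_n) :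
  arc_perm (tperm i j * sigma^-1 * tperm i j)%g -> arc_perm (tperm i j * sigma * tperm i j)%g.
Proof. by move=> ap; apply: arc_permV; rewrite !invMg tpermV mulgA. Qed.

Lemma flip_rev sigma s s' (i j : 'I_n) :
  cyc_repr sigma s -> cyc_repr sigma^-1%g s' -> flip s i j = flip s' i j.
Proof.
move=> rs rs'; rewrite /flip !(cyc_repr_prev _ rs) !(cyc_repr_prev _ rs') invgK.
by case: rs rs' => _ nx [_ nx']; rewrite !nx !nx' addbC.
Qed.

(** [pair_step] covers the side given by the orientation. On the other side it is applied to the
    inverse cycle, whose orientation is opposite. *)
Lemma side_step sigma tau w x l (i j : 'I_n) :
    size w = n./2 -> cyc_repr sigma (build n tau w) -> l.+1 < n./2 ->
    i = lab n x l :> nat -> j = lab n x l.+1 :> nat -> flip (build n tau w) i j ->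
  arc_perm (tperm i j * sigma * tperm i j)%g.
Proof.
move=> sz_w rs lt_l def_i def_j.
have [p [a2 [a1 [w0 [def_w sz_w0]]]]] : exists p a2 a1 w0, w = p ++ [:: a2, a1 & w0] /\ size w0 = l.
  exists (take (n./2 - l.+2) w); rewrite -{1}(cat_take_drop (n./2 - l.+2) w).
  have : size (drop (n./2 - l.+2) w) = l.+2 by rewrite size_drop; lia.
  by case: drop => [|a2 [|a1 w0]] //= [sz]; exists a2, a1, w0.
move: sz_w rs def_i def_j; rewrite {w}def_w -{l lt_l}sz_w0.
have [ox|ox] := eqVneq (ori tau w0) x.
  by rewrite -ox => sz_w rs def_i def_j; apply: pair_step rs _ _.
move=> sz_w rs def_i def_j.
have rs' := cyc_repr_inv_build rs; rewrite (flip_rev _ _ rs rs') => fl.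
apply: arc_perm_conjV; rewrite map_cat /= in rs' fl.
apply: pair_step rs' _ _ fl; rewrite ?size_map ?ori_swap //.
- by rewrite -sz_w !size_cat /= !size_map.
- by rewrite def_i; case: x ori ox {def_i def_j} => [] [].
by rewrite def_j; case: x ori ox {def_i def_j} => [] [].
Qed.

(** As soon as there is an outer letter, exchanging the two middle values changes the length,
    contrary to the hypothesis. Otherwise [n] is 2 and the word has one letter. *)
Lemma even_center_step sigma tau p a (i j : 'I_n) :
    ~~ odd n -> size (p ++ [:: a]) = n./2 -> cyc_repr sigma (build n tau (p ++ [:: a])) ->
    i = lab n true 0 :> nat -> j = lab n false 0 :> nat ->
    (0 < size p -> flip (build n tau (p ++ [:: a])) i j) ->
  arc_perm (tperm i j * sigma * tperm i j)%g.
Proof.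
move=> even_n sz_w rs def_i def_j.
have n_gt1 : 1 < n by move: sz_w; rewrite size_cat /=; lia.
case: (posnP (size p)) => [/size0nil p0 _|p_gt0 /(_ isT)].
  rewrite p0 /= in rs sz_w *; have := cyc_repr_tperm i j rs; rewrite /= (negbTE even_n) => rs'.
  exists tau, [:: if a is D then L else D]; split=> //.
  move: rs'; rewrite /= (negbTE even_n) def_i def_j /swapn /lab.
  by case: a {rs sz_w}; case: tau => /=; repeat case: eqP => //; move=> *; lia.
set o1 := ori tau [:: a].
have a_n0 : build n tau [:: a] != [::] by rewrite -size_eq0 size_build /=; lia.
have [t [rs' _ /(_ (lab n true 0) p_gt0)[hd tl]]] := context_cycle n_gt1 sz_w a_n0 rs.
rewrite (flip_eq _ _ rs rs'); have {rs' rs} := cyc_repr_uniq rs'.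
have -> : build n tau [:: a] = [:: lab n o1 0; lab n (~~ o1) 0].
  by rewrite /o1 /=; case: (a); rewrite /= ?negbK (negbTE even_n).
move: hd tl; rewrite -/o1 def_i def_j; case: o1 => /= hd tl Us.
  rewrite (@flip_cat _ [::] _ (lab n false 0 :: t) [:: lab n true 0] _ t) //=.
  case: t hd tl {Us} => [|y t] /=; rewrite /outside /lab /=; lia.
rewrite (@flip_cat _ [:: lab n false 0] _ t [::] _ (lab n true 0 :: t)) //=.
case: t hd tl {Us} => [|y t] /=; rewrite /outside /lab /=; lia.
Qed.

(** Passing to the inverse if necessary, the middle value is exchanged with its neighbour on side
    [tau]. This negates [tau] and turns an innermost R into D, or D into L. An innermost L would
    change the length unless it is also outermost, and then it may be read as R. *)
Lemma odd_center_step sigma tau w x (i j : 'I_n) :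
    odd n -> size w = n./2 -> 0 < n./2 -> cyc_repr sigma (build n tau w) ->
    i = n./2 :> nat -> j = lab n x 0 :> nat -> flip (build n tau w) i j ->
  arc_perm (tperm i j * sigma * tperm i j)%g.
Proof.
move=> odd_n; wlog: sigma tau w / x = tau => [IH|->].
  have [|/eqP xt] := eqVneq x tau; first exact: IH.
  move=> sz_w r_gt0 rs def_i def_j fl; have rs' := cyc_repr_inv_build rs.
  apply: arc_perm_conjV; apply: (IH _ _ _ _ _ _ rs') => //; rewrite ?size_map //.
    by move: xt; clear; case: x tau => [] [].
  by rewrite -(flip_rev _ _ rs rs').
move=> sz_w r_gt0 rs def_i def_j fl.
have [p [a def_w]] : exists p a, w = p ++ [:: a].
  by case/lastP: w sz_w {rs fl} => [|p a]; [move=> /=; lia | exists p, a; rewrite cats1].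
rewrite {w}def_w in sz_w rs fl.
have mv a' b : size (p ++ [:: a']) = n./2 -> cyc_repr sigma (build n tau (p ++ [:: a'])) ->
    ori (~~ tau) [:: b] = ori tau [:: a'] ->
    map (swapn i j) (build n tau [:: a']) = build n (~~ tau) [:: b] ->
    arc_perm (tperm i j * sigma * tperm i j)%g.
  move=> sz' rs' oE mapE; exists (~~ tau), (p ++ [:: b]); split; first by rewrite -sz' !size_cat.
  apply: (swap_context sz' rs' oE _ _ _ mapE) => //;
    by rewrite mem_build ?def_i ?def_j //= /lab; case: (tau); lia.
have mvR : cyc_repr sigma (build n tau (p ++ [:: R])) -> arc_perm (tperm i j * sigma * tperm i j)%g.
  move=> rs'; apply: (mv R D) => //; [by rewrite -sz_w !size_cat | by rewrite /= negbK |].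
  rewrite /= odd_n def_i def_j /= negbK /swapn /lab.
  by case: (tau) => /=; repeat case: eqP => //; move=> *; lia.
case: a sz_w rs fl => sz_w rs fl.
- case: (posnP (size p)) => [/size0nil p0|p_gt0].
    rewrite p0 in rs mvR; apply: mvR => /=.
    have [s1 [s2 [e1 e2]]] := build_outer n L R tau [::].
    by move: rs; move: e1 e2 => /= -> -> /cyc_repr_rot.
  have n_gt1 : 1 < n by lia.
  have a_n0 : build n tau [:: L] != [::] by rewrite -size_eq0 size_build /=; lia.
  have [t [rs' _ /(_ 0 p_gt0)[hd tl]]] := context_cycle n_gt1 sz_w a_n0 rs.
  move: fl; rewrite (flip_eq _ _ rs rs'); have {rs' rs} := cyc_repr_uniq rs'.
  rewrite /= odd_n def_i def_j /= => Us.
  rewrite (@flip_cat _ [:: lab n tau 0; lab n (~~ tau) 0] _ t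
                       [::] _ (lab n (~~ tau) 0 :: n./2 :: t)) //=.
  case: t hd tl {Us} => [|y t] /=; rewrite /outside /lab; case: (tau) => /=; lia.
- exact: mvR.
apply: (mv D L) => //; rewrite /= odd_n def_i def_j /= negbK /swapn /lab.
by case: (tau) => /=; repeat case: eqP => //; move=> *; lia.
Qed.

End Steps.

(** * Encoded cycles and the relation generated by conjugation *)

Section Classes.

Variable n : nat.
Implicit Types (sigma : 'S_n) (tau o : bool) (p w : seq letter).

Lemma arc_perm_step sigma (i j : 'I_n) : j = i.+1 :> nat ->
    coxlen (tperm i j * sigma * tperm i j) = coxlen sigma ->
  arc_perm sigma -> arc_perm (tperm i j * sigma * tperm i j)%g.
Proof.
move=> ji eq_len [tau [w [sz_w rs]]]; have lt_j := ltn_ord j.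
have fl_ij : 2 < n -> flip (build n tau w) i j.
  by move=> n_gt2; rewrite -(coxlen_flip n_gt2 rs ji) eq_len.
have fl_ji : 2 < n -> flip (build n tau w) j i.
  by move=> n_gt2; rewrite (flip_sym rs) ?fl_ij // -val_eqE /=; lia.
(* On the low side, values decrease away from the middle, so [i] and [j] change roles. *)
have [lt_i|le_i] := ltnP i (n./2).-1.
  rewrite tpermC.
  by apply: (@side_step _ _ _ _ true (n./2 - i.+2) _ _ sz_w rs); rewrite ?fl_ji /lab; lia.
have [lt_i|{}le_i] := ltnP i n./2.
  have n_gt1 : 1 < n by lia.
  case: (boolP (odd n)) => odd_n.
    rewrite tpermC.
    by apply: (@odd_center_step _ _ _ _ true _ _ odd_n sz_w _ rs); rewrite ?fl_ji /lab; lia.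
  case/lastP: w sz_w rs fl_ij {fl_ji} => [|p a]; first by move=> /=; lia.
  rewrite -cats1 => sz_w rs fl_ij.
  apply: (even_center_step odd_n sz_w rs); rewrite /lab; try lia.
  by move=> p_gt0; apply: fl_ij; move: sz_w; rewrite size_cat /=; lia.
have [lt_i|{}le_i] := ltnP i (n - n./2).
  have odd_n : odd n by lia.
  by apply: (@odd_center_step _ _ _ _ false _ _ odd_n sz_w _ rs); rewrite ?fl_ij /lab; lia.
by apply: (@side_step _ _ _ _ false (i - (n - n./2)) _ _ sz_w rs); rewrite ?fl_ij /lab; lia.
Qed.

Lemma cyc_stepP (w w' : 'S_n) :
  reflect (exists i j : 'I_n, [/\ j = i.+1 :> nat, w' = (tperm i j * w * tperm i j)%g
             & coxlen w' <= coxlen w]) (cyc_step w w').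
Proof.
apply: (iffP existsP) => [[i /existsP[j /and3P[/eqP ji /eqP -> le]]]|[i [j [ji def_w' le]]]].
  by exists i, j.
by exists i; apply/existsP; exists j; rewrite le ji def_w' !eqxx.
Qed.

Lemma cyc_to_coxlen (w w' : 'S_n) : cyc_to w w' -> coxlen w' <= coxlen w.
Proof.
case/connectP=> s; elim: s w => [|x s IHs] w /=; first by move=> _ ->.
case/andP=> /cyc_stepP[i [j [_ _ le_x]]] /IHs le_s /le_s le_w'.
exact: leq_trans le_w' le_x.
Qed.

(** Lengths never increase along a path, and the path back to [w] prevents a loss; hence every step
    preserves the length. *)
Lemma arc_perm_class (w w' : 'S_n) : cyc_equiv w w' -> arc_perm w -> arc_perm w'.
Proof.
case/andP=> /connectP[s ps ->] /cyc_to_coxlen.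
elim: s w ps => [|x s IHs] w //= /andP[/cyc_stepP[i [j [ji def_x le_x]]] ps] le_w ap_w.
have le_s : coxlen (last x s) <= coxlen x by apply: cyc_to_coxlen; apply/connectP; exists s.
apply: IHs => //; first exact: leq_trans le_w.
rewrite def_x; apply: arc_perm_step => //.
by apply/eqP; rewrite eqn_leq -def_x le_x (leq_trans le_w).
Qed.

Lemma cyc_equiv_refl (w : 'S_n) : cyc_equiv w w.
Proof. by rewrite /cyc_equiv /cyc_to connect0. Qed.

Lemma cyc_equiv_sym (w w' : 'S_n) : cyc_equiv w w' = cyc_equiv w' w.
Proof. by rewrite /cyc_equiv andbC. Qed.

Lemma cyc_equiv_trans : transitive (@cyc_equiv n).
Proof.
move=> w2 w1 w3 /andP[to12 to21] /andP[to23 to32].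
by apply/andP; split; [apply: connect_trans to23 | apply: connect_trans to21].
Qed.

(** A length-preserving conjugation is undone by the same generator. *)
Lemma cyc_equiv_flip sigma s (i j : 'I_n) : 2 < n -> cyc_repr sigma s ->
    (j = i.+1 :> nat) \/ (i = j.+1 :> nat) -> flip s i j ->
  cyc_equiv sigma (tperm i j * sigma * tperm i j)%g.
Proof.
move=> n_gt2 rs; wlog ji : i j / j = i.+1 :> nat => [IH|_ fl].
  case=> [ji|ij] fl; first by apply: IH => //; left.
  rewrite tpermC; apply: IH => //; first by left.
  by rewrite (flip_sym rs) // -val_eqE /=; lia.
have eq_len := coxlen_flip n_gt2 rs ji; rewrite fl in eq_len; have {eq_len}/eqP eq_len := eq_len.
apply/andP; split; apply/connect1/cyc_stepP; exists i, j; split; rewrite ?eq_len //.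
by rewrite !mulgA tperm2 mul1g -mulgA tperm2 mulg1.
Qed.

(** * Rewriting every word to L...L *)

Definition reaches tau w tau' w' := forall sigma, cyc_repr sigma (build n tau w) ->
  exists2 sigma', cyc_repr sigma' (build n tau' w') & cyc_equiv sigma sigma'.

Lemma reaches_trans tau1 w1 tau2 w2 tau3 w3 :
  reaches tau1 w1 tau2 w2 -> reaches tau2 w2 tau3 w3 -> reaches tau1 w1 tau3 w3.
Proof.
move=> r12 r23 sigma1 /r12[sigma2 /r23[sigma3 rs3 eq23] eq12].
by exists sigma3 => //; apply: cyc_equiv_trans eq23.
Qed.

Lemma reaches_outer tau a b w : reaches tau (a :: w) tau (b :: w).
Proof.
move=> sigma; have [s1 [s2 [-> ->]]] := build_outer n a b tau w.
by move=> /cyc_repr_rot rs; exists sigma; rewrite ?cyc_equiv_refl.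
Qed.

(** Reduces the rewriting of an inner factor to one evaluation of [flip], where the rest [t] of the
    cycle is known only through its end values. *)
Lemma reaches_swap tau p w tau' w' y z : 2 < n ->
    size (p ++ w) = n./2 -> ori tau' w' = ori tau w -> size w' = size w ->
    y \in build n tau w -> z \in build n tau w -> (z == y.+1) || (y == z.+1) ->
    map (swapn y z) (build n tau w) = build n tau' w' ->
    (forall t, uniq (build n tau w ++ t) -> (size p = 0 -> t = [::]) ->
       (forall d, 0 < size p -> outside n (ori tau w) (size w) (head d t)
                             /\ outside n (~~ ori tau w) (size w) (last d t)) ->
       flip (build n tau w ++ t) y z) ->
  reaches tau (p ++ w) tau' (p ++ w').
Proof.
move=> n_gt2 sz_w oE sE yB zB adj mapE fl sigma rs.
have le_w : size w <= n./2 by move: sz_w; rewrite size_cat; lia.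
have lt_y : y < n by move: yB; rewrite mem_build //; lia.
have lt_z : z < n by move: zB; rewrite mem_build //; lia.
pose i := Ordinal lt_y; pose j := Ordinal lt_z.
exists (tperm i j * sigma * tperm i j)%g.
  exact: (swap_context (i := i) (j := j) sz_w rs oE sE yB zB mapE).
have w_n0 : build n tau w != [::] by apply/eqP => w0; rewrite w0 in yB.
have [t [rs' t0 out]] := context_cycle (ltnW n_gt2) sz_w w_n0 rs.
apply: (cyc_equiv_flip n_gt2 rs'); first by case/orP: adj => /eqP; [left | right].
by apply: fl; first exact: cyc_repr_uniq rs'.
Qed.

Lemma reaches_LD tau p w : size (p ++ [:: L, D & w]) = n./2 ->
  reaches tau (p ++ [:: L, D & w]) tau (p ++ [:: D, L & w]).
Proof.
move=> sz_w; have lt_w : (size w).+1 < n./2 by move: sz_w; rewrite size_cat /=; lia.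
have mE := swapn_DL tau lt_w.
apply: (reaches_swap (y := lab n (ori tau w) (size w)) (z := lab n (ori tau w) (size w).+1)) => //.
- lia.
- by apply: lab_mem => /=; lia.
- by apply: lab_mem => /=; lia.
- by rewrite /lab; case: ori => /=; lia.
- by rewrite -mE (mapK (swapnK _ _)).
rewrite [build n tau [:: L, D & w]]/= negbK.
have := last_build tau (lab n (~~ ori tau w) (size w)) (ltnW (ltnW lt_w)).
move: (build n tau w) => s ins t.
pose k := lab n (ori tau w) (size w); pose k1 := lab n (ori tau w) (size w).+1.
pose k' := lab n (~~ ori tau w) (size w); pose k1' := lab n (~~ ori tau w) (size w).+1.
rewrite -/k -/k1 -/k' -/k1' /= -!catA => Us t0 out.
rewrite (@flip_cat _ [:: k1', k1, k' & s] k t [:: k1'] k1 (k' :: s ++ k :: t)) //=.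
rewrite ?last_cat /=; have := out k1'; case: (posnP (size p)) => [/t0 -> _|p_gt0 /(_ isT)];
  by move: ins; rewrite /outside /k /k1 /k' /k1' /lab; case: ori => /=; lia.
Qed.

Lemma reaches_LR tau p w : size (p ++ [:: L, R & w]) = n./2 ->
  reaches tau (p ++ [:: L, R & w]) tau (p ++ [:: D, D & w]).
Proof.
move=> sz_w; have lt_w : (size w).+1 < n./2 by move: sz_w; rewrite size_cat /=; lia.
apply: (reaches_swap (y := lab n (~~ ori tau w) (size w))
                     (z := lab n (~~ ori tau w) (size w).+1)) => //.
- lia.
- by rewrite /= negbK.
- by apply: lab_mem => /=; lia.
- by apply: lab_mem => /=; lia.
- by rewrite /lab; case: ori => /=; lia.
- exact: swapn_LR.
rewrite [build n tau [:: L, R & w]]/=.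
have := head_build tau (lab n (ori tau w) (size w)) (ltnW (ltnW lt_w)).
move: (build n tau w) => s ins t.
pose k := lab n (ori tau w) (size w); pose k1 := lab n (ori tau w) (size w).+1.
pose k' := lab n (~~ ori tau w) (size w); pose k1' := lab n (~~ ori tau w) (size w).+1.
rewrite -/k -/k1 -/k' -/k1' /= -!catA => Us t0 out.
rewrite (@flip_cat _ [:: k1, k1' & s ++ [:: k]] k' t [:: k1] k1' (s ++ [:: k, k' & t]))
  /= -?catA //=.
rewrite ?last_cat /=.
have -> : head k1 (s ++ [:: k, k' & t]) = head k s by case: (s).
have := out k1; case: (posnP (size p)) => [/t0 -> _|p_gt0 /(_ isT)];
  by move: ins; rewrite /outside /k /k1 /k' /k1' /lab; case: ori => /=; lia.
Qed.

(** The exchange of the middle value with the value just below it corrects [tau], at the price of an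
    innermost D. *)
Lemma reaches_center p : odd n -> size (p ++ [:: L]) = n./2 ->
  reaches false (p ++ [:: L]) true (p ++ [:: D]).
Proof.
move=> odd_n sz_w; have r_gt0 : 0 < n./2 by move: sz_w; rewrite size_cat /=; lia.
apply: (reaches_swap (y := n./2) (z := lab n true 0)) => //.
- lia.
- by rewrite mem_build //=; lia.
- by apply: lab_mem => //=; lia.
- by rewrite /lab; lia.
- by rewrite /= odd_n /swapn /lab /=; repeat case: eqP => //; move=> *; lia.
move=> t; rewrite /= odd_n => Us t0 out.
rewrite (@flip_cat _ [:: lab n false 0; lab n true 0] _ t [:: lab n false 0] _ (n./2 :: t)) //=.
have := out (lab n false 0); case: (posnP (size p)) => [/t0 -> _|p_gt0 /(_ isT)];
  by rewrite /outside /lab /=; lia.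
Qed.

(* Each letter can be changed to L from the outside in: the outermost one is
   free, and an inner D, or an inner R turned into D, moves outwards. *)
Lemma reaches_nseq tau p w : size (p ++ w) = n./2 ->
  reaches tau (p ++ w) tau (nseq (size p) L ++ w).
Proof.
have nseqS j s : nseq j.+1 L ++ s = nseq j L ++ L :: s by elim: j => //= j ->.
move: {-1}(size p) (erefl (size p)) => k.
elim: k p w => [|k IHk] p w sz_p sz_w.
  by move: sz_p => /size0nil -> sigma rs; exists sigma; rewrite ?cyc_equiv_refl.
case: k IHk sz_p => [_|k IHk sz_p].
  by case: p sz_w => [|a []] //= _ _; apply: reaches_outer.
case/lastP: p sz_p sz_w => // p a; rewrite size_rcons cat_rcons nseqS => -[sz_p] sz_w.
have sz_k b2 b1 : size (nseq k L ++ [:: b2, b1 & w]) = n./2.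
  by rewrite -sz_w !size_cat sz_p size_nseq /= addSnnS.
have toL b2 b1 : reaches tau (nseq k L ++ [:: b2, b1 & w]) tau (nseq k.+1 L ++ b1 :: w).
  by rewrite -cat_rcons; apply: IHk; rewrite ?size_rcons ?size_nseq // cat_rcons.
have stepD : reaches tau (nseq k.+1 L ++ D :: w) tau (nseq k.+1 L ++ L :: w).
  by rewrite nseqS; apply: reaches_trans (reaches_LD (sz_k L D)) (toL D L).
apply: reaches_trans (IHk p (a :: w) sz_p sz_w) _.
case: a {sz_w} => //; first by move=> sigma rs; exists sigma; rewrite ?cyc_equiv_refl.
rewrite nseqS; apply: reaches_trans (reaches_LR (sz_k L R)) _.
exact: reaches_trans (toL D D) stepD.
Qed.

(** All letters are turned into L; if [tau] is false, it is corrected at the middle value and the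
    resulting D is removed by a second round. *)
Lemma reaches_stair tau w : 1 < n -> odd n || tau -> size w = n./2 ->
  reaches tau w true (nseq n./2 L).
Proof.
move=> n_gt1 odd_tau sz_w.
have toL tau' w' : size w' = n./2 -> reaches tau' w' tau' (nseq n./2 L).
  by move=> sz_w'; have := @reaches_nseq tau' w' [::]; rewrite !cats0 sz_w'; apply.
case: tau odd_tau => [_|]; first exact: toL.
rewrite orbF => odd_n; apply: reaches_trans (toL _ _ sz_w) _.
have sz b : size (nseq n./2.-1 L ++ [:: b]) = n./2 by rewrite size_cat size_nseq /=; lia.
have {1}-> : nseq n./2 L = nseq n./2.-1 L ++ [:: L].
  have : 0 < n./2 by lia.
  by case: n./2 => // r _; elim: r => //= r ->.
exact: reaches_trans (reaches_center odd_n (sz L)) (toL true _ (sz D)).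
Qed.

End Classes.

(** * Oscillating cycles with connected intervals are encoded by words *)

(** Each further L puts two values in front and thus shifts the indices by two. For [k = n./2] the
    formula gives the stair sequence. *)
Lemma nth_stair n k i : k <= n./2 -> i < odd n + k.*2 ->
  nth 0 (build n true (nseq k L)) i
    = if odd i then n - n./2 + k - i./2 - 1 else n./2 - k + i./2.
Proof.
elim: k i => [|k IHk] i le_k lt_i.
  by move: lt_i => /=; case: ifP => odd_n; case: i => [|[]] //=; lia.
have ori_nseq : ori true (nseq k L) = true by elim: (k).
rewrite /= ori_nseq size_nseq; case: i lt_i => [|[|i]] /= lt_i; rewrite /lab //=; try lia.
by rewrite IHk ?(ltnW le_k) ?negbK; try lia; case: ifP; lia.
Qed.

Lemma cyc_repr_stair n : cyc_repr (stair_perm n) (build n true (nseq n./2 L)).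
Proof.
have def_s : map val (stair_seq n) = build n true (nseq n./2 L).
  rewrite /stair_seq; apply: (@eq_from_nth _ 0).
    by rewrite size_build 2!size_map size_enum_ord size_nseq; lia.
  move=> i; rewrite 2!size_map size_enum_ord => lt_i; rewrite nth_stair ?leqnn //; last lia.
  rewrite -map_comp (nth_map (Ordinal lt_i)) ?size_enum_ord //= nth_enum_ord // /stair_val /=.
  case: (boolP (odd i)) => odd_i /=; lia.
split; first by rewrite perm_build ?size_nseq.
move=> i; rewrite -def_s (next_map val_inj) ?stair_seq_uniq //.
by rewrite permE.
Qed.

(** * Encoded cycles are oscillating with connected intervals *)

Lemma oscillating_mid n (sigma : 'S_n) m :
  sigma @: intv n 1 m = intv n (n - m + 1) n <->
  forall x : 'I_n, (x < m) = (n - m <= sigma x).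
Proof.
have intvE (x : 'I_n) : ((x \in intv n 1 m) = (x < m))
    * ((x \in intv n (n - m + 1) n) = (n - m <= x)).
  by have := ltn_ord x; split; rewrite inE; lia.
split=> [/setP im x|im].
  by rewrite -(intvE x).1 -(intvE (sigma x)).2 -im mem_imset //; apply: perm_inj.
apply/setP=> y; rewrite -(permKV sigma y) mem_imset; last exact: perm_inj.
by rewrite !intvE.
Qed.

Lemma arc_perm_oscillating n (sigma : 'S_n) : 1 < n -> arc_perm sigma -> oscillating sigma.
Proof.
move=> n_gt1 [tau [w [sz_w rs]]]; exists (mid n tau); split; first exact: mid_gt0.
  by rewrite /mid; case: (tau); lia.
apply/oscillating_mid=> x; have cyc := cycle_build tau n_gt1 (eq_leq sz_w).
have := next_cycle cyc; rewrite /alt => /(_ x).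
by rewrite (mem_cyc_repr _ rs) ltn_ord; case: rs => _ -> /(_ isT)/eqP.
Qed.

Lemma traject_repr n (sigma : 'S_n) s (x : 'I_n) : cyc_repr sigma (val x :: s) ->
  map val (traject sigma x n) = val x :: s.
Proof.
move=> rs; have Us := cyc_repr_uniq rs; have sz := cyc_repr_size rs; have [_ nx] := rs.
have mapE (y : 'I_n) k : map val (traject sigma y k) = traject (next (val x :: s)) y k.
  by elim: k y => // k IHk y; rewrite !trajectS map_cons IHk nx.
have := cycle_next Us; rewrite mapE [path.cycle _ _]/= rcons_path => /andP[/fpathE def_s _].
by rewrite [in RHS]def_s -trajectS; congr (traject _ _ _); rewrite -sz.
Qed.

(** Without its [k.-1] outermost letters the word encodes an arc of the cycle whose values fill
    exactly the interval for [k]. *)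
Lemma arc_perm_connected n (sigma : 'S_n) : arc_perm sigma -> connected_intervals sigma.
Proof.
move=> [tau [w [sz_w rs]]] k k_gt0 le_k.
pose p := take k.-1 w; pose w0 := drop k.-1 w.
have sz_w0 : size w0 = n./2 - k.-1 by rewrite size_drop sz_w.
have [u [v ctx]] := build_context n p (ori tau w0) (size w0).
have {}rs : cyc_repr sigma (build n tau w0 ++ v ++ u).
  by move: rs; rewrite -(cat_take_drop k.-1 w) ctx // => /cyc_repr_rot; rewrite catA.
have le_w0 : size w0 <= n./2 by rewrite sz_w0; lia.
case def_B: (build n tau w0) rs => [|b B].
  by move/(congr1 size): def_B; rewrite size_build /=; lia.
move=> rs; have lt_b : b < n by rewrite -(mem_cyc_repr _ rs) mem_head.
set M := intv _ _ _; pose T := traject sigma (Ordinal lt_b) (size (b :: B)).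
have mapT : map val T = b :: B.
  have sz_B : size (b :: B) <= n.
    by rewrite -(cyc_repr_size rs) /= ltnS size_cat leq_addr.
  rewrite /T -(take_traject _ _ sz_B) map_take (traject_repr (x := Ordinal lt_b) rs).
  by rewrite -cat_cons take_size_cat.
have memT x : (x \in T) = (x \in M).
  rewrite -(mem_map val_inj) mapT -def_B mem_build // sz_w0 /M /intv inE /=.
  by have := ltn_ord x; lia.
have defM : M = [set x in T] by apply/setP=> x; rewrite [RHS]inE memT.
have szM : #|M| = size (b :: B).
  rewrite defM cardsE; have /card_uniqP -> : uniq T; last by rewrite size_traject.
  by rewrite -(map_inj_uniq val_inj) mapT -def_B build_uniq.
exists (Ordinal lt_b); last by rewrite szM.
by rewrite -memT /T /= mem_head.
Qed.

(** * Reading off a word from nested arcs *)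

Lemma card_intv n a b : 0 < a -> b <= n -> #|intv n a b| = b.+1 - a.
Proof.
move=> a_gt0 le_b.
have lt_f (i : 'I_(b.+1 - a)) : a.-1 + i < n by have := ltn_ord i; lia.
rewrite -[RHS]card_ord -(card_imset predT (f := fun i => Ordinal (lt_f i))); last first.
  by move=> i i' /(congr1 val) /= /addnI/val_inj.
apply: eq_card => x; rewrite inE; apply/idP/imsetP => [x_ab|[i _ ->] /=]; last first.
  by have := ltn_ord i; lia.
have lt_x : x - a.-1 < b.+1 - a by lia.
by exists (Ordinal lt_x) => //; apply: val_inj => /=; lia.
Qed.

Section ArcOfIntervals.

Variables (n : nat) (sigma : 'S_n).
Hypothesis cyc_sigma : is_ncycle sigma.

Lemma porbit_ncycle x : porbit sigma x = setT.
Proof.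
by apply/set1P; rewrite -cyc_sigma; apply: imset_f.
Qed.

Lemma ncycle_stable (S : {set 'I_n}) x :
  x \in S -> (forall y, y \in S -> sigma y \in S) -> S = setT.
Proof.
move=> xS stS; apply/setP=> y; rewrite inE.
have /porbitP[i ->] : y \in porbit sigma x by rewrite porbit_ncycle inE.
by rewrite permX; elim: i => //= i IHi; apply: stS.
Qed.

Lemma traject_ncycle x : [set y in traject sigma x n] = setT.
Proof.
apply/setP=> y; rewrite !inE.
have := porbit_traject sigma x y; rewrite porbit_ncycle inE cardsT card_ord => <- //.
Qed.

(** An arc of length [q] inside one of length [q.+2] starts at most two places later. If it starts
    later than that, it runs past the end of [M], so [M] is stable and contains everything; then it
    may be started at [x]. *)
Lemma connected_traject (M : {set 'I_n}) q x : #|M| = q.+2 -> connected_in sigma M ->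
    0 < q -> {subset traject sigma x q <= M} ->
  exists y e, [/\ M = [set z in traject sigma y q.+2], e <= 2 & iter e sigma y = x].
Proof.
move=> szM [y _]; rewrite szM => defM q_gt0 sub.
have xM : x \in M by apply: sub; case: (q) q_gt0 => //= q' _; rewrite mem_head.
have /trajectP[e lt_e def_x] : x \in traject sigma y q.+2 by rewrite defM inE in xM.
have [le_e|gt_e] := leqP e 2; first by exists y, e.
have MT : M = setT.
  apply: (ncycle_stable xM) => z; rewrite {1}defM inE => /trajectP[i lt_i ->].
  rewrite -iterS; have [lt_i1|ge_i1] := ltnP i.+1 q.+2.
    by rewrite defM inE; apply/trajectP; exists i.+1.
  apply: sub; apply/trajectP; exists (i.+1 - e); first lia.
  by rewrite def_x -iterD subnK //; lia.
exists x, 0; split=> //; rewrite -szM MT cardsT card_ord traject_ncycle //.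
Qed.

End ArcOfIntervals.

(** Connectedness of the next interval places its two new values around the known arc, and
    oscillation decides which of them is low. *)
Lemma arc_extend n (sigma : 'S_n) tau w (x : 'I_n) : 1 < n ->
    is_ncycle sigma -> (forall y : 'I_n, (y < mid n tau) = (n - mid n tau <= sigma y)) ->
    connected_intervals sigma -> size w < n./2 ->
    build n tau w = map val (traject sigma x (odd n + (size w).*2)) ->
  exists a y, build n tau (a :: w) = map val (traject sigma y (odd n + (size w).+1.*2)).
Proof.
move=> n_gt1 cyc osc conn lt_w def_w; set j := size w in lt_w def_w *.
set q := odd n + j.*2 in def_w *.
have -> : odd n + j.+1.*2 = q.+2 by rewrite /q; lia.
pose k := n./2 - j; pose M := intv n k (n - k + 1); pose T := traject sigma x q.
have memT z : (z \in T) = (n./2 - j <= z < n - n./2 + j).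
  by rewrite -(mem_map val_inj) -def_w mem_build // ltnW.
have memM (z : 'I_n) : (z \in M) = (n./2 - j.+1 <= z < n - n./2 + j.+1).
  by have := ltn_ord z; rewrite /M /intv inE /k; lia.
have szM : #|M| = q.+2 by rewrite card_intv /q /k; lia.
have connM : connected_in sigma M by apply: conn; rewrite /k; lia.
have new (z : 'I_n) : z \in M -> z \notin T -> val z = lab n (z < mid n tau) j.
  rewrite memT memM => zM zT.
  have [b def_z] : exists b, val z = lab n b j.
    by case: (ltnP z (n./2 - j)) => h; [exists true | exists false]; rewrite /lab /=; lia.
  by rewrite [in RHS](_ : (z : nat) = lab n b j) ?lab_mid.
have [y [e [defM le_e q_e]]] : exists y e, [/\ M = [set z in traject sigma y q.+2], e <= 2
    & if q == 0 then e = 0 else iter e sigma y = x].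
  case: (posnP q) => [q0|q_gt0].
    by have [y _] := connM; rewrite szM => defM; exists y, 0.
  have [|y [e [defM le_e ex]]] := connected_traject cyc szM connM q_gt0 (x := x).
    by move=> z; rewrite -/T memT memM; lia.
  by exists y, e.
have UT : uniq (traject sigma y q.+2).
  by apply/card_uniqP; rewrite size_traject -[RHS]szM defM cardsE.
have subM z : z \in traject sigma y q.+2 -> z \in M by rewrite defM in_set.
have newD (z t : 'I_n) : z \in M -> z \notin T -> t \in M -> t \notin T -> z != t ->
    (t < mid n tau) = ~~ (z < mid n tau).
  move=> zM zT tM tT; rewrite -val_eqE (new z) // (new t) //.
  by case: (z < _); case: (t < _); rewrite ?eqxx.
pose o := ori tau w; pose m := mid n tau.
(* When the known arc is empty, the side of the first of the two values decides between R and D. *)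
case: (posnP q) => [q0|q_gt0].
  rewrite q0 /= in q_e def_w UT subM *.
  have T0 z : z \notin T by rewrite /T q0.
  have yM : y \in M by rewrite subM // mem_head.
  have syM : sigma y \in M by rewrite subM // !inE eqxx orbT.
  have neq_y : y != sigma y by move: UT; rewrite inE andbT.
  have lt_sy := newD _ _ yM (T0 _) syM (T0 _) neq_y.
  have def_y := new _ yM (T0 _); have def_sy := new _ syM (T0 _).
  have [lt_y|lt_y] := eqVneq (y < mid n tau) o.
    by exists R, y; rewrite [RHS]/= def_y def_sy lt_sy lt_y /= def_w.
  exists D, y; rewrite [RHS]/= def_y def_sy lt_sy /= def_w -/o -/j.
  by move: lt_y; case: (_ < _); case: o.
rewrite (gtn_eqF q_gt0) in q_e.
have def_T : T = x :: behead T by rewrite /T; case: (q) q_gt0.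
have [hd_x last_T] : (n - m <= x) = ~~ o /\ (n - m <= iter q sigma x) = ~~ o.
  have [|hd lst] := build_ends n_gt1 (ltnW lt_w) (x := x) (s := map val (behead T)) (tau := tau).
    by rewrite def_w -/T def_T.
  split=> //; rewrite -(prednK q_gt0) iterS -osc -/m -lst.
  by rewrite last_map -/m /T -(prednK q_gt0) /= last_traject.
have new_in (z : 'I_n) (s1 s2 : seq 'I_n) :
    traject sigma y q.+2 = s1 ++ T ++ s2 -> z \in s1 ++ s2 -> z \in M /\ z \notin T.
  move=> def_s zs; split.
    apply: subM; rewrite def_s !mem_cat; move: zs; rewrite mem_cat.
    by case/orP=> ->; rewrite ?orbT.
  have := UT; rewrite def_s uniq_catCA => /[!cat_uniq] /and3P[_ /hasPn out _].
  exact: out zs.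
(* The number [e] of new values in front of the old arc gives the letter: R for none, D for one, L
   for two. *)
case: e le_e q_e => [|[|[|//]]] _ q_e; rewrite /= in q_e.
- have def_s : traject sigma y q.+2 = [::] ++ T ++ [:: iter q sigma x; iter q.+1 sigma x].
    by rewrite !trajectSr -!cats1 -catA q_e.
  have [zM zT] := new_in (iter q sigma x) _ _ def_s (mem_head _ _).
  have [tM tT] := new_in (iter q.+1 sigma x) _ _ def_s
    (mem_last (iter q sigma x) [:: iter q.+1 sigma x]).
  have neq : iter q sigma x != iter q.+1 sigma x.
    by move: UT; rewrite def_s cat0s cat_uniq => /and3P[_ _]; rewrite /= inE andbT.
  have def_z := new _ zM zT; have lt_z : (iter q sigma x < mid n tau) = o.
    by apply: negb_inj; rewrite -last_T -[X in n - m <= X]/(val _) def_z lab_mid.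
  exists R, y; rewrite def_s !map_cat /= def_w def_z (new _ tM tT) (newD _ _ zM zT tM tT neq).
  by rewrite lt_z.
- have def_s : traject sigma y q.+2 = [:: y] ++ T ++ [:: iter q sigma x].
    by rewrite trajectS trajectSr -cats1 q_e.
  have [yM yT] := new_in y _ _ def_s (mem_head _ _).
  have [tM tT] := new_in (iter q sigma x) _ _ def_s (mem_last y [:: iter q sigma x]).
  have neq : y != iter q sigma x.
    move: UT; rewrite def_s /= mem_cat negb_or inE => /andP[/andP[_ ->]] //.
  have lt_y : (y < mid n tau) = ~~ o by rewrite osc q_e.
  exists D, y; rewrite def_s !map_cat /= def_w (new _ yM yT) (new _ tM tT).
  by rewrite (newD _ _ yM yT tM tT neq) lt_y negbK.
have def_s : traject sigma y q.+2 = [:: y; sigma y] ++ T ++ [::].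
  by rewrite cats0 2!trajectS q_e.
have [yM yT] := new_in y _ _ def_s (mem_head _ _).
have [tM tT] := new_in (sigma y) _ _ def_s (mem_last y [:: sigma y]).
have neq : sigma y != y.
  by move: UT; rewrite def_s /= inE negb_or eq_sym => /andP[/andP[]].
have lt_sy : (sigma y < mid n tau) = ~~ o by rewrite osc q_e.
exists L, y; rewrite def_s !map_cat /= cats0 def_w (new _ yM yT) (new _ tM tT).
by rewrite (newD _ _ tM tT yM yT neq) lt_sy negbK.
Qed.

Lemma arc_perm_of_intervals n (sigma : 'S_n) : 1 < n -> is_ncycle sigma ->
    oscillating sigma -> connected_intervals sigma ->
  exists tau w, [/\ odd n || tau, size w = n./2 & cyc_repr sigma (build n tau w)].
Proof.
move=> n_gt1 cyc [m [m_gt0 val_m /oscillating_mid osc]] conn.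
(* For even [n] the only possible [m] is [n./2], and [tau] is taken to be true; for odd [n] it is
   read off from [m]. *)
have [tau [odd_tau def_m]] : exists tau, odd n || tau /\ m = mid n tau.
  have [->|ne_m] := eqVneq m n./2; first by exists true; rewrite orbT.
  by exists false; rewrite /mid; split; lia.
rewrite {m m_gt0 val_m}def_m in osc.
have arc j : j <= n./2 -> exists w x, size w = j
    /\ build n tau w = map val (traject sigma x (odd n + j.*2)).
  elim: j => [_|j IHj lt_j].
    (* For odd [n] this is the middle value; for even [n] the trajectory is empty and any start will
       do. *)
    have lt_r : n./2 < n by lia.
    by exists [::], (Ordinal lt_r); split=> //=; case: odd.
  have [w [x [sz_w def_w]]] := IHj (ltnW lt_j).
  rewrite -sz_w in lt_j def_w *.
  by have [a [y def_aw]] := arc_extend n_gt1 cyc osc conn lt_j def_w; exists (a :: w), y.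
have [w [x [sz_w]]] := arc _ (leqnn _); rewrite odd_double_half => def_w.
exists tau, w; split=> //; split; first exact: perm_build.
have fcyc k : 0 < k -> iter k sigma x = x -> fcycle sigma (traject sigma x k).
  case: k => //= k _ it.
  by rewrite rcons_path fpath_traject last_traject /= it eqxx.
have it : iter n sigma x = x.
  by have := iter_porbit sigma x; rewrite porbit_ncycle // cardsT card_ord.
move=> i; rewrite def_w (next_map val_inj); last first.
  by rewrite -(map_inj_uniq val_inj) -def_w build_uniq ?sz_w.
rewrite (nextE (fcyc n (ltnW n_gt1) it)) //; have : i \in [set y in traject sigma x n].
  by rewrite traject_ncycle // inE.
by rewrite in_set.
Qed.

Theorem theorem4p20 (n : nat) (hn : 1 <= n) (sigma : 'S_n)
    (hsigma : is_ncycle sigma) :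
  sigma \in stair_class n <-> oscillating sigma /\ connected_intervals sigma.
Proof.
(* The case of one point is separate because [mid] may vanish there, while oscillation asks for a
   positive [m]. *)
rewrite inE; have [n_gt1|n_le1] := ltnP 1 n; last first.
  have n1 : n = 1 by lia.
  have eq_ord (x y : 'I_n) : x = y.
    by apply: val_inj; have := ltn_ord x; have := ltn_ord y => /=; lia.
  have -> : sigma = stair_perm n by apply/permP=> x.
  rewrite cyc_equiv_refl; split=> // _; split=> [|k]; last by lia.
  exists 1; split=> //; first by rewrite n1.
  by apply/oscillating_mid=> x; have := ltn_ord x; have := ltn_ord (stair_perm n x); lia.
split=> [equiv|[osc conn]].
  have ap : arc_perm sigma.
    apply: arc_perm_class equiv _; exists true, (nseq n./2 L).
    by rewrite size_nseq; split=> //; apply: cyc_repr_stair.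
  by split; [apply: arc_perm_oscillating | apply: arc_perm_connected].
have [tau [w [odd_tau sz_w rs]]] := arc_perm_of_intervals n_gt1 hsigma osc conn.
have [sigma' rs' equiv] := reaches_stair n_gt1 odd_tau sz_w rs.
(* A list represents at most one permutation, so the cycle reached is the stair element. *)
by rewrite (cyc_repr_inj (cyc_repr_stair n) rs') cyc_equiv_sym.
Qed.
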